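(* Let $G^*$ be a graph with $s$ terminals in which the distance between any two terminals is between $1$ and $\beta$. Suppose that the distortion for the SPR problem on $G^*$ is at least $\alpha$. Then for any positive integer $L$ with $\max\{2,\lceil\beta\rceil\}\le L\le\lceil\alpha\beta\rceil$, there exists a constant $c_4=c_4(s)>0$ such that for infinitely many $k\in\mathbb{N}$ there exists a graph $G$ with $k$ terminals such that for all $\epsilon>0$, $G$ does not have a $$\left(\min\left\{L/\beta,\ \alpha\right\}-\epsilon,\ c_4\,k^{L/(L-1)}\right)\text{-DAM}.$$
   Context: Graphs $G=(V,E,\ell)$ are finite and undirected, with an edge length function $\ell:E\to\mathbb{R}^+$ and a designated set $T\subset V$ of vertices called terminals; the other vertices are non-terminals. $d_G$ is the shortest-path distance. A minor of $G$ is a graph obtained by a sequence of vertex deletions, edge deletions and edge contractions, where no terminal may be deleted and no two terminals may be contracted together (so every terminal survives; a super-node containing terminal $t$ is identified with $t$); a minor carries its own edge length function $\ell'$. A minor $H=(V',E',\ell')$ of $G$ is an $\alpha$-distance approximating minor ($\alpha$-DAM) of $G$ if $d_G(t,t')\le d_H(t,t')\le\alpha\cdot d_G(t,t')$ for all $t,t'\in T$. It is an $(\alpha,y)$-DAM if in addition it has at most $y$ non-terminals. The Steiner Point Removal (SPR) problem on a graph is to find an $(\alpha',0)$-DAM (a DAM with no non-terminals) with $\alpha'$ as small as possible; ''the distortion for the SPR problem on $G^*$ is at least $\alpha$'' means that $\alpha'\ge\alpha$ whenever $G^*$ has an $(\alpha',0)$-DAM. The input graph $G^*$ is connected and has $s\ge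 2$ terminals. *)

(* Defs.v *)
From HB Require Import structures.
From mathcomp Require Import all_boot all_order all_algebra.
From mathcomp Require Import boolp classical_sets cardinality reals
  constructive_ereal ereal exp.

Set Implicit Arguments.
Unset Strict Implicit.
Unset Printing Implicit Defensive.
Import Order.TTheory GRing.Theory Num.Theory.

Local Open Scope ring_scope.

(* An undirected edge is a two-element set of vertices. The vertex set is a
   subset of the ambient type V, so that all minors of a graph live on V. *)
Record graph (V : finType) := Graph {
  vertices : {set V};
  edges : {set {set V}};
  _ : [forall e in edges, (#|e| == 2%N) && (e \subset vertices)]
}.

Record lgraph (R : realType) (V : finType) := LGraph {
  base :> graph V;
  len : {set V} -> R;
  _ : forall e, e \in edges base -> 0 < len e
}.

Section Distance.
Context {R : realType} {V : finType}.

Definition adj (G : graph V) : rel V := fun x y => [set x; y]%SET \in edges G.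

Definition connected_graph (G : graph V) : Prop :=
  forall x y, x \in vertices G -> y \in vertices G -> connect (adj G) x y.

Fixpoint walk_length (l : {set V} -> R) (x : V) (p : seq V) : R :=
  if p is y :: q then l [set x; y]%SET + walk_length l y q else 0.

(* Equal to +oo when no walk joins x to y. *)
Definition dist (G : lgraph R V) (x y : V) : \bar R :=
  ereal_inf [set d | exists p : seq V,
    [/\ path (adj G) x p, last x p = y & d = (walk_length (len G) x p)%:E]]%classic.

End Distance.

Section Minor.
Context {V : finType}.

Definition deletes_vertex (x : V) (G H : graph V) : Prop :=
  [/\ x \in vertices G, vertices H = vertices G :\ x
    & edges H = [set e in edges G | x \notin e]%SET].

Definition deletes_edge (e : {set V}) (G H : graph V) : Prop :=
  [/\ e \in edges G, vertices H = vertices G & edges H = edges G :\ e].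

(* The super-node created by contracting the edge uv keeps the name v.
   The cardinality condition discards the loop coming from uv itself. *)
Definition contracts (u v : V) (G H : graph V) : Prop :=
  let f x := if x == u then v else x in
  [/\ [set u; v]%SET \in edges G, vertices H = vertices G :\ u
    & edges H = [set e in [set f @: e' | e' : {set V} in edges G]
                | #|e| == 2%N]%SET].

(* Since u is not a terminal, a contraction never merges two terminals, and a
   super-node containing a terminal carries the name of that terminal; so the
   terminal set of every minor is T itself. *)
Inductive minor_step (T : {set V}) (G H : graph V) : Prop :=
| step_delete_vertex x of x \notin T & deletes_vertex x G H
| step_delete_edge e of deletes_edge e G H
| step_contract u v of u \notin T & contracts u v G H.

Inductive minor (T : {set V}) (G : graph V) : graph V -> Prop :=
| minor_refl : minor T G G
| minor_trans H K of minor T G H & minor_step T H K : minor T G K.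

End Minor.

Section DAM.
Context {R : realType} {V : finType}.

Definition is_DAM (T : {set V}) (G : lgraph R V) (alpha : R)
    (H : lgraph R V) : Prop :=
  minor T G H /\
  forall t t', t \in T -> t' \in T ->
    (dist G t t' <= dist H t t')%E /\
    (dist H t t' <= alpha%:E * dist G t t')%E.

Definition has_DAM (T : {set V}) (G : lgraph R V) (alpha y : R) : Prop :=
  exists H : lgraph R V,
    is_DAM T G alpha H /\ #|vertices H :\: T|%:R <= y.

Definition SPR_distortion_ge (T : {set V}) (G : lgraph R V) (alpha : R) : Prop :=
  forall alpha', has_DAM T G alpha' 0 -> alpha <= alpha'.

End DAM.

(* Main.v *)
(** Take a hypergraph on k vertices with edges of size s, girth greater than L
    and about k^(L/(L-1)) edges, and glue a copy of G* along each hyperedge.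
    If a minor H has fewer non-terminals than there are copies, then it contains
    no non-terminal of some copy, so the part of H inside that copy solves the
    SPR problem on G*.  A walk of H that leaves this copy at one terminal and
    comes back at another makes at least L hops of length at least 1, whereas
    terminals of the copy are at distance at most beta in G.  So if H has
    distortion less than L/beta, its distances between terminals of the copy are
    realized inside the copy, and its distortion is at least alpha. *)
Require Import Defs.
From HB Require Import structures.
From mathcomp Require Import all_boot all_order all_algebra.
From mathcomp Require Import boolp classical_sets cardinality reals
  constructive_ereal ereal exp.
From mathcomp Require Import zify lra.

Set Implicit Arguments.
Unset Strict Implicit.
Unset Printing Implicit Defensive.
Import Order.TTheory GRing.Theory Num.Theory.

Local Open Scope ring_scope.

(** * Hypergraphs of high girth *)

Section Hypergraph.
Local Open Scope nat_scope.
Context {K : finType}.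
Implicit Types (F : {set {set K}}) (e : {set K}) (x y z : K).

Definition hop F x y := (x == y) || [exists e in F, (x \in e) && (y \in e)].

(** As [hop] is reflexive, this means at most [n] hops, not exactly [n]. *)
Fixpoint reach F n x y :=
  if n is m.+1 then [exists z, hop F x z && reach F m z y] else x == y.

Definition degree F x := #|[set e in F | x \in e]%SET|.

Definition uniform s F := forall e, e \in F -> #|e| = s.

(** Such an [e] and [n] hops avoiding it would close a cycle of length [n.+1 <= L]. For [1 < L], the
    case [n = 1] makes two hyperedges share at most one vertex. *)
Definition girth_gt L F := forall e x y n, e \in F -> x \in e -> y \in e ->
  n < L -> reach (F :\ e)%SET n x y -> x = y.

Lemma hop_refl F x : hop F x x.
Proof. by rewrite /hop eqxx. Qed.

Lemma hopC F x y : hop F x y = hop F y x.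
Proof.
rewrite /hop eq_sym; congr (_ || _); apply: eq_existsb => e.
by rewrite [(x \in e) && _]andbC.
Qed.

Lemma hop_edge F e x y : e \in F -> x \in e -> y \in e -> hop F x y.
Proof.
by move=> eF xe ye; apply/orP; right; apply/exists_inP; exists e; rewrite ?xe.
Qed.

Lemma reach_step F n x y z : hop F x y -> reach F n y z -> reach F n.+1 x z.
Proof. by move=> xy yz; apply/existsP; exists y; rewrite xy. Qed.

Lemma reach_trans F m n x y z :
  reach F m x y -> reach F n y z -> reach F (m + n) x z.
Proof.
elim: m x => [|m IH] x /=; first by move/eqP ->.
by case/existsP=> t /andP[xt ty] yz; apply: reach_step xt (IH _ ty yz).
Qed.

Lemma reach_refl F n x : reach F n x x.
Proof. by elim: n => //= n IH; apply: reach_step (hop_refl _ _) IH. Qed.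

Lemma reach_mono F m n x y : m <= n -> reach F m x y -> reach F n x y.
Proof.
by move=> /subnKC <- xy; apply: reach_trans xy (reach_refl _ _ _).
Qed.

Lemma reachC F n x y : reach F n x y = reach F n y x.
Proof.
suff {x y} H x y : reach F n x y -> reach F n y x by apply/idP/idP; apply: H.
elim: n x => [|n IH] x /=; first by rewrite eq_sym.
case/existsP=> z /andP[xz /IH yz]; rewrite hopC in xz.
change (reach F n.+1 y x); rewrite -addn1; apply: reach_trans yz _ => /=.
by apply/existsP; exists x; rewrite xz eqxx.
Qed.

Lemma reach_sub F1 F2 n x y : F1 \subset F2 -> reach F1 n x y -> reach F2 n x y.
Proof.
move=> F12; elim: n x => [|n IH] x //= /existsP[z /andP[xz /IH zy]].
apply: reach_step zy; case/orP: xz => [/eqP ->|/exists_inP[e eF /andP[xe ze]]].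
  exact: hop_refl.
by apply: hop_edge xe ze; apply: (fintype.subsetP F12).
Qed.

Lemma card_bigcup_le (J : finType) (P : {set J}) (B : J -> {set K}) m :
  (forall j, j \in P -> #|B j| <= m) -> #|\bigcup_(j in P) B j| <= #|P| * m.
Proof.
move=> Bm; rewrite -sum_nat_const.
apply: (big_ind2 (fun (A : {set K}) n => #|A| <= n)) => [|A1 n1 A2 n2 H1 H2|//].
  by rewrite cards0.
exact: leq_trans (leq_card_setU _ _) (leq_add H1 H2).
Qed.

(** The vertex [x] itself and [s.-1] others on each of at most [D] hyperedges give
    [1 + D * (s - 1)], which is at most [s * D] as [0 < D]. *)
Lemma card_hop F s D x : 0 < s -> 0 < D -> uniform s F -> degree F x <= D ->
  #|[set y | hop F x y]%SET| <= s * D.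
Proof.
move=> s0 D0 sF dx; set Fx := [set e in F | x \in e]%SET.
have sub : [set y | hop F x y]%SET
    \subset (x |: \bigcup_(e in Fx) (e :\ x))%SET.
  apply/fintype.subsetP => y; rewrite !inE /hop (eq_sym x y).
  case/orP=> [->//|].
  case/exists_inP=> e eF /andP[xe ye]; case: (eqVneq y x) => //= yx.
  by apply/bigcupP; exists e; rewrite !inE ?eF ?yx.
apply: leq_trans (subset_leq_card sub) _; rewrite cardsU1.
have H : #|\bigcup_(e in Fx) (e :\ x)%SET| <= #|Fx| * s.-1.
  apply: card_bigcup_le => e; rewrite inE => /andP[/sF es xe].
  by rewrite -es (cardsD1 x e) xe.
have H2 : #|Fx| * s.-1 <= D * s.-1 by rewrite leq_mul2r dx orbT.
case: s s0 {sF} H H2 => // s _ /= H H2; case: D D0 {dx} H2 => // D _ H2.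
by case: (_ \notin _); nia.
Qed.

Lemma card_reach F s D n x : 0 < s -> 0 < D -> uniform s F ->
  (forall y, degree F y <= D) -> #|[set y | reach F n x y]%SET| <= (s * D) ^ n.
Proof.
move=> s0 D0 sF dF; elim: n x => [|n IH] x.
  rewrite expn0 -(cards1 x); apply: subset_leq_card.
  by apply/fintype.subsetP => y; rewrite !inE eq_sym.
set N := [set z | hop F x z]%SET.
have sub : [set y | reach F n.+1 x y]%SET
    \subset (\bigcup_(z in N) [set y | reach F n z y])%SET.
  apply/fintype.subsetP => y; rewrite inE => /existsP[z /andP[xz zy]].
  by apply/bigcupP; exists z; rewrite inE.
apply: leq_trans (subset_leq_card sub) _.
apply: leq_trans (card_bigcup_le (fun z _ => IH z)) _.
by rewrite expnS leq_mul2r card_hop ?orbT.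
Qed.

(* The vertices of a new edge are pairwise far apart, so an old short path that
   uses it can be rerouted. *)
Lemma reach_setU1 F (X : {set K}) n x y : reach (X |: F)%SET n x y ->
  reach F n x y \/
  exists a b m1 m2, [/\ a \in X, b \in X, reach F m1 x a, reach F m2 b y
    & m1 + m2 < n].
Proof.
elim: n x => [|n IH] x; first by left.
case/existsP=> z /andP[xz /IH zy].
have [[xX zX]|{}xz] : (x \in X /\ z \in X) \/ hop F x z.
  case/orP: xz => [/eqP->|/exists_inP[e]]; first by right; apply: hop_refl.
  rewrite inE => /orP[/set1P -> /andP[? ?]|eF /andP[? ?]]; first by left.
  by right; apply: hop_edge eF _ _.
(* The walk enters [X] at [x] itself: take [a := x] with [m1 = 0] and keep only the part after the
   exit vertex. *)
- right; case: zy => [zy|[a [b [m1 [m2 [aX bX za yb lt]]]]]].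
    by exists x, z, 0, n; split=> //=.
  by exists x, b, 0, m2; split=> //=; lia.
- case: zy => [zy|[a [b [m1 [m2 [aX bX za yb lt]]]]]].
    by left; apply: reach_step zy.
  right; exists a, b, m1.+1, m2; split=> //.
  exact: reach_step za.
Qed.

(** Cutting [X] out of a short cycle leaves a walk of at most [L.-1] hops of [F] between two
    vertices of [X]. If they differ, they are not far apart; if they coincide, the cycle closes up
    without [X]. *)
Lemma girth_gt_setU1 F (X : {set K}) L : girth_gt L F ->
  {in X &, forall x y, x != y -> ~~ reach F L.-1 x y} ->
  girth_gt L (X |: F)%SET.
Proof.
move=> gF far e x y n; have [-> _|eX] := eqVneq e X.
  move=> xX yX nL r; apply/eqP; apply: contraTT isT => xy.
  have /negP[] := far x y xX yX xy.
  apply: (@reach_mono _ n); first by lia.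
  by apply: reach_sub r; apply/fintype.subsetP => f; rewrite !inE; case: eqVneq.
rewrite !inE (negbTE eX) /= => eF xe ye nL.
have -> : ((X |: F) :\ e = X |: (F :\ e))%SET.
  apply/setP => f; rewrite !inE; case: (eqVneq f X) => [->|_] /=; last by [].
  by rewrite eq_sym eX.
have sub : (F :\ e \subset F)%SET by apply: finset.subsetDl.
case/reach_setU1 => [r|[a [b [m1 [m2 [aX bX xa yb lt]]]]]].
  exact: gF eF xe ye nL r.
have [ab|ab] := eqVneq b a.
  rewrite -ab in xa.
  by apply: (gF e x y (m1 + m2) eF xe ye) (reach_trans xa yb); lia.
have /negP[] := far b a bX aX ab.
apply: (@reach_mono _ (m2 + m1.+1)); first by lia.
apply: reach_trans (reach_sub sub yb) _.
exact: reach_step (hop_edge eF ye xe) (reach_sub sub xa).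
Qed.

(** Greedy choice: the balls of radius [n] around the vertices chosen so far have at most
    [(s * D) ^ n] elements each, too few to cover [A]. *)
Lemma far_subset F s D n m (A : {set K}) : 0 < s -> 0 < D -> uniform s F ->
  (forall y, degree F y <= D) -> m * (s * D) ^ n <= #|A| ->
  exists X : {set K}, [/\ X \subset A, #|X| = m
    & {in X &, forall x y, x != y -> ~~ reach F n x y}].
Proof.
move=> s0 D0 sF dF; elim: m => [|m IH] Am.
  by exists finset.set0; rewrite finset.sub0set cards0;
    split=> // x y; rewrite inE.
have [|X [XA Xm far]] := IH.
  by apply: leq_trans Am; rewrite leq_mul2r leqnSn orbT.
set U := (\bigcup_(x in X) [set y | reach F n x y])%SET.
have cU : #|U| <= m * (s * D) ^ n.
  by rewrite -Xm; apply: card_bigcup_le => x _; apply: card_reach.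
have : (A :\: U)%SET != finset.set0.
  rewrite -card_gt0 cardsD subn_gt0.
  apply: leq_ltn_trans (subset_leq_card (finset.subsetIr _ _)) _.
  apply: leq_ltn_trans cU _; apply: leq_trans Am.
  by rewrite ltn_pmul2r // expn_gt0 muln_gt0 s0 D0.
case/finset.set0Pn=> a; rewrite inE => /andP[aU aA].
have faraX x : x \in X -> ~~ reach F n x a.
  by move=> xX; apply: contra aU => r; apply/bigcupP; exists x; rewrite ?inE.
have aX : a \notin X.
  by apply/negP => /faraX; rewrite reach_refl.
exists (a |: X)%SET; split.
- apply/fintype.subsetP => x; rewrite !inE.
  by move=> /orP[/eqP ->|/(fintype.subsetP XA)].
- by rewrite cardsU1 aX Xm.
move=> x y; rewrite !inE => /orP[/eqP ->|xX] /orP[/eqP ->|yX].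
- by rewrite eqxx.
- by rewrite reachC => _; apply: faraX.
- by move=> _; apply: faraX.
- exact: far.
Qed.

Lemma sum_degree F s : uniform s F -> \sum_x degree F x = #|F| * s.
Proof.
move=> sF; transitivity (\sum_x \sum_(e in F) (x \in e : nat)).
  apply: eq_bigr => x _; rewrite /degree -sum1dep_card big_mkcondr /=.
  by apply: eq_bigr => e _; case: (x \in e).
rewrite exchange_big /= -sum_nat_const; apply: eq_bigr => e eF.
by rewrite -big_mkcond sum1_card sF.
Qed.

(* Erdos-Sachs: take an edge-maximal hypergraph of degree at most D.  Its
   vertices of degree less than D cannot contain s vertices pairwise at
   distance at least L, so there are few of them. *)
Theorem exists_high_girth s D L : 1 < s -> 0 < D -> 1 < L ->
  #|K| = 2 * s * (s * D) ^ L.-1 ->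
  exists F, [/\ uniform s F, girth_gt L F & (s * D) ^ L.-1 * D <= #|F|].
Proof.
move=> s1 D0 L1 cK; have s0 : 0 < s by lia.
pose P F := `[< [/\ uniform s F, girth_gt L F & forall x, degree F x <= D] >].
have P0 : P finset.set0.
  apply/asboolP; split=> [e|e x y n|x]; rewrite ?inE //.
  rewrite /degree (_ : finset _ = finset.set0) ?cards0 //.
  by apply/setP=> e; rewrite !inE.
case: (arg_maxnP (fun F : {set {set K}} => #|F|) P0).
move=> F /asboolP[uF gF dF] maxF.
exists F; split=> //; set B := (s * D) ^ L.-1 in cK *.
pose A := [set x | degree F x < D]%SET.
have cA : #|A| <= s * B.
  rewrite leqNgt; apply/negP => /ltnW /(far_subset s0 D0 uF dF)[X [XA Xs far]].
  (* Distinct vertices of a hyperedge are one hop apart, and [1 <= L.-1]. *)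
  have XF : X \notin F.
    apply/negP => XF.
    have /card_gt1P[x [y [xX yX xy]]] : 1 < #|X| by rewrite Xs.
    have /negP[] := far x y xX yX xy.
    apply: (@reach_mono _ 1); first by lia.
    by apply: reach_step (hop_edge XF xX yX) _; rewrite /= eqxx.
  have /maxF : P (X |: F)%SET.
    apply/asboolP; split=> [e|//|x].
    - by rewrite !inE => /orP[/eqP -> //|]; apply: uF.
    - exact: girth_gt_setU1.
    - rewrite /degree; have [xX|xX] := boolP (x \in X).
        have : x \in A by apply: (fintype.subsetP XA).
        rewrite inE; apply: leq_trans.
        rewrite (_ : finset _ = X |: [set e in F | x \in e])%SET; last first.
          apply/setP=> e; rewrite !inE; case: (eqVneq e X) => // ->.
          by rewrite xX.
        by rewrite cardsU1; case: (_ \notin _); rewrite /degree ?add1n ?add0n.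
      apply: leq_trans (dF x); apply: subset_leq_card.
      apply/fintype.subsetP=> e; rewrite !inE => /andP[/orP[/eqP ->|->] //].
      by rewrite (negbTE xX).
  by rewrite /geq /= cardsU1 XF add1n ltnn.
(* Double counting of incidences: at least [s * B] of the [2 * s * B] vertices have degree at least
   [D]. *)
rewrite -(@leq_pmul2r s) // -(sum_degree uF).
have : \sum_(x in ~: A) D <= \sum_x degree F x.
  rewrite [leqRHS](bigID [in ~: A]) /=; apply: leq_trans (leq_addr _ _).
  by apply: leq_sum => x; rewrite !inE -leqNgt.
apply: leq_trans; rewrite sum_nat_const.
have := (finset.cardsC A); rewrite cK; nia.
Qed.

End Hypergraph.

(** * Gluing copies of a graph *)

Lemma graph_ext (V : finType) (G H : graph V) :
  vertices G = vertices H -> edges G = edges H -> G = H.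
Proof.
case: G H => [v e p] [v' e' p'] /= vv ee; rewrite -{}vv -{}ee in p' *.
by rewrite (bool_irrelevance p p').
Qed.

Section Graph.
Context {V : finType} (G : graph V).

Lemma edge_card2 e : e \in edges G -> #|e| == 2%N.
Proof. by case: G => ? ? /= /forall_inP H /H /andP[]. Qed.

Lemma edge_subset e : e \in edges G -> e \subset vertices G.
Proof. by case: G => ? ? /= /forall_inP H /H /andP[]. Qed.

End Graph.

Section Walks.
Context {R : realType} {V : finType} (G : lgraph R V).

Lemma len_gt0 e : e \in edges G -> 0 < len G e.
Proof. by case: G => ? ? /= H /H. Qed.

Lemma walk_length_ge0 x p : path (adj G) x p -> 0 <= walk_length (len G) x p.
Proof.
elim: p x => [|y p IH] x //= /andP[xy /IH]; apply: addr_ge0.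
exact/ltW/len_gt0.
Qed.

Lemma walk_length_cat (l : {set V} -> R) x p q :
  walk_length l x (p ++ q) = walk_length l x p + walk_length l (last x p) q.
Proof. by elim: p x => [|y p IH] x /=; rewrite ?add0r // IH addrA. Qed.

Lemma dist_le_walk x y p : path (adj G) x p -> last x p = y ->
  (dist G x y <= (walk_length (len G) x p)%:E)%E.
Proof. by move=> xp xy; apply: ereal_inf_lbound; exists p. Qed.

Lemma le_dist x y (d : \bar R) :
  (forall p, path (adj G) x p -> last x p = y ->
    (d <= (walk_length (len G) x p)%:E)%E) -> (d <= dist G x y)%E.
Proof. by move=> H; apply: le_ereal_inf_tmp => _ [p [xp xy ->]]; apply: H. Qed.

Lemma dist_refl x : dist G x x = 0%E.
Proof.
apply/eqP; rewrite eq_le (@dist_le_walk x x [::]) //=.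
by apply: le_dist => p xp _; rewrite lee_fin walk_length_ge0.
Qed.

End Walks.

Lemma dist_le_eq_len (R : realType) (V : finType) (G H : lgraph R V) x y :
  edges G = edges H -> {in edges G, len G =1 len H} ->
  (dist G x y <= dist H x y)%E.
Proof.
move=> GH lGH; have adjGH : adj G =2 adj H by move=> u v; rewrite /adj GH.
apply: le_dist => p; rewrite -(eq_path adjGH) => xp xy.
have -> : walk_length (len H) x p = walk_length (len G) x p.
  elim: p x xp {xy} => [|z p IH] x //= /andP[xz /IH ->].
  by rewrite lGH.
exact: dist_le_walk.
Qed.

Definition contr (V : finType) (u v x : V) := if x == u then v else x.

Lemma contr_id (V : finType) (u v : V) (e : {set V}) :
  u \notin e -> contr u v @: e = e.
Proof.
move=> ue; rewrite -[RHS]imset_id; apply: eq_in_imset => x xe.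
by rewrite /contr; case: eqVneq => // xu; rewrite -xu xe in ue.
Qed.

(** * Minors of a glued graph, seen from one copy *)

Section Gluing.
Context {V W I : finType} (T : {set V}) (S : {set W}) (phi : I -> V -> W).
Context (phi_inj : forall i, injective (phi i)).
Context (phi_S : forall i v, (phi i v \in S) = (v \in T)).
Context (phi_meet : forall i j x y, i != j -> phi i x = phi j y -> x \in T).
Context (phi_linear : forall i j x y x' y', i != j ->
  phi i x = phi j y -> phi i x' = phi j y' -> x = x').
Implicit Types X Y : graph W.

Fact pull_graph_proof i X :
  [forall e in [set e : {set V} | phi i @: e \in edges X]%SET,
    (#|e| == 2%N) && (e \subset (phi i @^-1: vertices X)%SET)].
Proof.
apply/forall_inP => e; rewrite inE => eX.
rewrite -(card_imset _ (@phi_inj i)) (edge_card2 eX) /=.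
by rewrite -sub_imset_pre (edge_subset eX).
Qed.

Definition pull i X := Graph (pull_graph_proof i X).

(** An invariant of minors: as every edge belongs to a copy, each contraction can be located in one
    copy. *)
Definition glued X := forall g, g \in edges X ->
  exists i (e : {set V}), g = phi i @: e.

(** An edge has two ends, whereas distinct copies meet in at most one vertex. *)
Lemma copies_share_no_edge i j (e e' : {set V}) :
  phi i @: e = phi j @: e' -> #|e| == 2%N -> i = j.
Proof.
move=> ee' /cards2P[x [x' [xx' ex]]]; apply/eqP/negPn/negP => ij.
have mem y : y \in e -> exists y', phi i y = phi j y'.
  by move/(imset_f (phi i)); rewrite ee' => /imsetP[y' _ ->]; exists y'.
have [|y xy] := mem x; first by rewrite ex !inE eqxx.
have [|y' xy'] := mem x'; first by rewrite ex !inE eqxx orbT.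
by rewrite (phi_linear ij xy xy') eqxx in xx'.
Qed.

Lemma contr_phi j a b (e : {set V}) :
  contr (phi j a) (phi j b) @: (phi j @: e) = phi j @: (contr a b @: e).
Proof.
rewrite -!imset_comp; apply: eq_imset => x /=; rewrite /contr.
by rewrite (inj_eq (@phi_inj j)); case: ifP.
Qed.

(** The renamed vertex is a non-terminal of copy [j], hence lies in no other copy. *)
Lemma contr_other h j a (w : W) (e : {set V}) : a \notin T -> h != j ->
  contr (phi j a) w @: (phi h @: e) = phi h @: e.
Proof.
move=> aT hj; apply: contr_id; apply/imsetP => -[x _ ax].
by move/negP: aT; apply; apply: phi_meet ax; rewrite eq_sym.
Qed.

Lemma glued_edge_ends X (u v : W) : glued X -> [set u; v]%SET \in edges X ->
  exists j a b, u = phi j a /\ v = phi j b.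
Proof.
move=> gX /gX[j [e uv]].
have /imsetP[a _ ->] : u \in phi j @: e by rewrite -uv !inE eqxx.
have /imsetP[b _ ->] : v \in phi j @: e by rewrite -uv !inE eqxx orbT.
by exists j, a, b.
Qed.

Lemma glued_step X Y : glued X -> minor_step S X Y -> glued Y.
Proof.
move=> gX [x _ [_ _ EY]|e [_ _ EY]|u v uS [uv _ EY]] g; rewrite EY.
- by rewrite inE => /andP[/gX].
- by rewrite !inE => /andP[_ /gX].
rewrite inE => /andP[/imsetP[g' /gX[h [e ->]] ->] _].
have [j [a [b [ua vb]]]] := glued_edge_ends gX uv.
rewrite {}ua phi_S in uS *; rewrite {}vb.
have [->|hj] := eqVneq h j.
  by exists j, (contr a b @: e); apply: contr_phi.
by exists h, e; apply: contr_other.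
Qed.

(** The contraction maps edges of each copy into the same copy, and copies share no edge; so an edge
    of [pull i Y] can only come from an edge of [X] in copy [i]. *)
Lemma pull_contracts X Y i j a b : glued X -> a \notin T ->
  contracts (phi j a) (phi j b) X Y ->
  if i == j then contracts a b (pull i X) (pull i Y) else pull i Y = pull i X.
Proof.
move=> gX aT [abX VY EY].
have edgeP e : e \in edges (pull i Y) =
    [exists g in edges X, (contr (phi j a) (phi j b) @: g == phi i @: e)]
      && (#|e| == 2%N).
  rewrite inE EY inE card_imset //; congr (_ && _).
  apply/imsetP/exists_inP => -[g gX' H]; exists g => //.
    by rewrite H.
  by rewrite (eqP H).
case: eqVneq => [ij|ij].
- rewrite {i}ij in edgeP *; split.
  + by rewrite inE imsetU1 imset_set1.
  + by apply/setP => x; rewrite !inE VY !inE (inj_eq (@phi_inj j)).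
  + apply/setP => e; rewrite edgeP inE; apply/andP/andP.
      case=> /exists_inP[g gE /eqP H] e2; split=> //.
      have [h [e' ge']] := gX _ gE; have [hj|hj] := eqVneq h j.
        apply/imsetP; exists e'; first by rewrite inE -hj -ge'.
        by apply: (imset_inj (@phi_inj j)); rewrite -H ge' hj contr_phi.
      move: H; rewrite ge' contr_other // => /esym/copies_share_no_edge H.
      by rewrite H ?eqxx in hj.
    case=> /imsetP[e' e'X ->] e2; split=> //; apply/exists_inP.
    by exists (phi j @: e'); [rewrite inE in e'X | rewrite contr_phi].
- apply: graph_ext; apply/setP.
    move=> x; rewrite !inE VY !inE; case: eqVneq => // xa.
    by case/negP: aT; apply: phi_meet (esym xa); rewrite eq_sym.
  move=> e; rewrite edgeP; apply/andP/idP.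
    case=> /exists_inP[g gE /eqP H] e2.
    have [h [e' ge']] := gX _ gE; have [hj|hj] := eqVneq h j.
      move: H; rewrite ge' hj contr_phi => /esym/copies_share_no_edge H.
      by rewrite H ?eqxx in ij.
    by move: H; rewrite ge' contr_other // inE => <-; rewrite -ge'.
  move=> eX; split; last exact: edge_card2 eX.
  rewrite inE in eX; apply/exists_inP; exists (phi i @: e) => //.
  by rewrite contr_other.
Qed.

Lemma pull_minor_step i X Y : glued X -> minor_step S X Y ->
  pull i Y = pull i X \/ minor_step T (pull i X) (pull i Y).
Proof.
move=> gX [x xS [xX VY EY]|g [gE VY EY]|u v uS cXY].
- have [/codomP[a xa]|xi] := boolP (x \in codom (phi i)).
    right; rewrite {}xa phi_S in xS xX VY EY *.
    apply: (step_delete_vertex xS); split; first by rewrite inE.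
      by apply/setP=> y; rewrite !inE VY !inE (inj_eq (@phi_inj i)).
    by apply/setP=> e; rewrite !inE EY !inE mem_imset.
  have xn y : phi i y != x by apply: contraNneq xi => <-; apply: codom_f.
  left; apply: graph_ext; apply/setP=> y; rewrite !inE ?VY ?EY !inE ?xn //.
  have -> : x \notin phi i @: y; last by rewrite andbT.
  by apply/imsetP => -[z _ xz]; case/eqP: (xn z).
- have [/imsetP[e _ ge]|gi] := boolP (g \in [set phi i @: e | e : {set V}]%SET).
    right; rewrite {}ge in gE EY *.
    apply: (@step_delete_edge _ _ _ _ e); split; rewrite ?inE //.
      by apply/setP=> y; rewrite !inE VY.
    move=> *; apply/setP=> e'.
    by rewrite !inE EY !inE (inj_eq (imset_inj (@phi_inj i))).
  left; apply: graph_ext; apply/setP=> y; rewrite !inE ?VY ?EY // !inE.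
  case: eqVneq => //= yg; case/negP: gi; rewrite -yg. apply/imsetP. by exists y.
case: (cXY) => uv _ _.
have [j [a [b [ua vb]]]] := glued_edge_ends gX uv.
rewrite {}ua {}vb phi_S in uS cXY *.
have := pull_contracts i gX uS cXY; case: eqVneq => _ H; last by left.
by right; apply: step_contract uS H.
Qed.

Lemma pull_minor i X Y : glued X -> minor S X Y ->
  glued Y /\ minor T (pull i X) (pull i Y).
Proof.
move=> gX; elim=> [|Y1 Y2 _ [gY1 m] st]; first by split=> //; apply: minor_refl.
split; first exact: glued_step gY1 st.
by case: (pull_minor_step i gY1 st) => [-> //|]; apply: minor_trans.
Qed.

(** * Distances in a glued graph and inside one copy *)

Section Distances.
Context {R : realType}.
Implicit Types (M : lgraph R W) (G : lgraph R V).

Fact pull_len_gt0 i M e : e \in edges (pull i M) -> 0 < len M (phi i @: e).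
Proof. by rewrite inE; apply: len_gt0. Qed.

Definition lpull i M : lgraph R V :=
  @LGraph R V (pull i M) (fun e => len M (phi i @: e)) (@pull_len_gt0 i M).

Lemma adj_pull i M : adj (lpull i M) =2 relpre (phi i) (adj M).
Proof. by move=> x y; rewrite /adj inE imsetU1 imset_set1. Qed.

Lemma walk_length_map i M x p :
  walk_length (len M) (phi i x) (map (phi i) p)
    = walk_length (len (lpull i M)) x p.
Proof.
by elim: p x => [|y p IH] x //=; rewrite IH imsetU1 imset_set1.
Qed.

Lemma dist_pull_ge i M x y :
  (dist M (phi i x) (phi i y) <= dist (lpull i M) x y)%E.
Proof.
apply: le_dist => p; rewrite (eq_path (adj_pull i M)) -path_map => xp xy.
by rewrite -walk_length_map; apply: dist_le_walk; rewrite // last_map xy.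
Qed.

(** The trace of a walk outside copy [i], one hop per crossed copy; it corresponds to [reach] in the
    hypergraph without the hyperedge of [i]. *)
Inductive hops (i : I) (b : W) : nat -> W -> Prop :=
| hops0 : hops i b 0 b
| hopsS n j x y of j != i & x \in T & y \in T & hops i b n (phi j y) :
    hops i b n.+1 (phi j x).

Context (L : nat).
Context (hops_far : forall i x y n, x \in T -> y \in T -> (n < L)%N ->
  hops i (phi i y) n (phi i x) -> x = y).

(** Shared by the glued graph and its DAMs; it lets the number of hops bound the length of a walk
    from below. *)
Definition separated M := forall j x p, path (adj (lpull j M)) x p ->
  x \in T -> last x p \in T -> x != last x p ->
  1 <= walk_length (len (lpull j M)) x p.

Section Shortcut.
Context (M : lgraph R W) (gM : glued M) (sM : separated M).
Context (i : I) (y : V) (yT : y \in T).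
Local Notation wlen j := (walk_length (len (lpull j M))).

(* The invariant of a walk from w to [phi i y]: it first runs inside the copy j
   up to a terminal, then hops outside the copy i until it enters that copy for
   good at the terminal z. *)
Inductive detour (l : R) (w : W) : Prop :=
| Detour j v q n z r of w = phi j v
    & path (adj (lpull j M)) v q & last v q \in T
    & hops i (phi i z) n (phi j (last v q)) & z \in T
    & path (adj (lpull i M)) z r & last z r = y
    & n%:R + wlen j v q + wlen i z r <= l.

(** A stretch between two terminals of copy [j] either returns to its start and is dropped, or has
    length at least 1, which pays for one more hop. *)
Lemma detour_hops j v q n z :
  path (adj (lpull j M)) v q -> v \in T -> last v q \in T -> j != i ->
  hops i z n (phi j (last v q)) ->
  exists2 m, hops i z m (phi j v) & m%:R <= n%:R + wlen j v q.
Proof.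
move=> vq vT lT ji h; have [vl|vl] := eqVneq v (last v q).
  by exists n; [rewrite vl | rewrite lerDl walk_length_ge0].
exists n.+1; first exact: hopsS h.
by rewrite -natr1 lerD2l sM.
Qed.

Lemma hops_lt n z j v q r (l : R) : path (adj (lpull j M)) v q ->
  path (adj (lpull i M)) z r -> n%:R + wlen j v q + wlen i z r <= l ->
  l < L%:R -> (n < L)%N.
Proof.
move=> /walk_length_ge0 q0 /walk_length_ge0 r0 le lL; rewrite -(ltr_nat R).
by apply: le_lt_trans lL; apply: le_trans le; rewrite -addrA lerDl addr_ge0.
Qed.

(** Induction from the end of the walk: an edge of copy [h] is put before a detour starting in copy
    [j]. If the copies differ they meet in a terminal, so the stretch [q] is complete and can be
    absorbed. *)
Lemma walk_detour w p : path (adj M) w p -> last w p = phi i y ->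
  walk_length (len M) w p < L%:R -> detour (walk_length (len M) w p) w.
Proof.
elim: p w => [|w1 p IH] w /=.
  move=> _ -> _.
  apply: (@Detour _ _ i y [::] 0%N y [::]); rewrite //= ?addr0 //.
  exact: hops0.
move=> /andP[ww1 w1p] lp; have ww1_gt0 := len_gt0 ww1.
set l := walk_length _ w1 p; set d := len M _ in ww1_gt0 *.
move=> dlL; have lL : l < L%:R by apply: le_lt_trans dlL; rewrite lerDr ltW.
case: (IH _ w1p lp lL) => j v q n z r w1E vq lT hz zT zr ry; rewrite -/l => le.
have [h [a [b [wE w1E']]]] := glued_edge_ends gM ww1.
have dE : d = len M (phi h @: [set a; b]%SET).
  by rewrite imsetU1 imset_set1 -wE -w1E'.
have hab : adj (lpull h M) a b by rewrite adj_pull /= -wE -w1E'.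
have [hj|hj] := eqVneq h j.
  rewrite {h}hj in wE w1E' dE hab.
  have bv : b = v by apply: (@phi_inj j); rewrite -w1E -w1E'.
  apply: (@Detour _ _ j a (b :: q) n z r); rewrite //= ?hab bv //.
  by move: le; rewrite /= -bv -dE => le; lra.
have phE : phi h b = phi j v by rewrite -w1E' w1E.
have vT : v \in T by apply: phi_meet (esym phE); rewrite eq_sym.
have bT : b \in T by apply: phi_meet phE.
have [ji|ji] := eqVneq j i.
  (* Fewer than [L] hops outside copy [i] join two of its terminals, which must coincide; so
     [q ++ r] is one final stretch in copy [i]. *)
  rewrite {j}ji in hj w1E vq lT hz le phE.
  have lz := hops_far lT zT (hops_lt vq zr le lL) hz.
  apply: (@Detour _ _ h a [:: b] 0%N v (q ++ r)); rewrite //= ?hab //.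
  - by rewrite phE; apply: hops0.
  - by rewrite cat_path vq lz.
  - by rewrite last_cat lz.
  rewrite walk_length_cat lz -dE.
  have : 0 <= n%:R :> R by []. lra.
have [m hm mle] := detour_hops vq vT lT ji hz.
apply: (@Detour _ _ h a [:: b] m z r); rewrite //= ?hab ?phE //.
by rewrite -dE; lra.
Qed.

Lemma pull_walk x p : path (adj M) (phi i x) p -> last (phi i x) p = phi i y ->
  walk_length (len M) (phi i x) p < L%:R ->
  exists q, [/\ path (adj (lpull i M)) x q, last x q = y
    & wlen i x q <= walk_length (len M) (phi i x) p].
Proof.
move=> xp xy pL.
case: (walk_detour xp xy pL) => j v q n z r xE vq lT hz zT zr ry le.
have n0 : 0 <= n%:R :> R by [].
have q0 := walk_length_ge0 vq; have r0 := walk_length_ge0 zr.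
have nL := hops_lt vq zr le pL.
have [ji|ji] := eqVneq j i.
  rewrite {j}ji in xE vq lT hz le q0 nL.
  have xv := phi_inj xE; rewrite -xv in vq lT hz le q0 nL.
  have lz := hops_far lT zT nL hz.
  exists (q ++ r); rewrite cat_path vq last_cat walk_length_cat lz; split=> //.
  lra.
(* The walk starts in another copy, so [x] is a terminal; the hops back to copy [i] force [x = z],
   and [r] alone suffices. *)
have vT : v \in T by apply: phi_meet (esym xE).
have xT : x \in T by apply: phi_meet xE; rewrite eq_sym.
have [m hm mle] := detour_hops vq vT lT ji hz.
rewrite -xE in hm; have xz : x = z.
  apply: hops_far xT zT _ hm.
  rewrite -(ltr_nat R); apply: le_lt_trans pL; apply: le_trans le; lra.
by exists r; rewrite xz in le *; split=> //; lra.
Qed.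

(** Only walks shorter than [L] can be moved into copy [i], hence the minimum with [L]. *)
Lemma dist_pull_le x :
  (Order.min L%:R%:E (dist (lpull i M) x y) <= dist M (phi i x) (phi i y))%E.
Proof.
apply: le_dist => p xp xy; rewrite ge_min.
have [pL|pL] := leP L%:R (walk_length (len M) (phi i x) p).
  by rewrite lee_fin pL.
have [q [xq qy qp]] := pull_walk xp xy pL; apply/orP; right.
by apply: le_trans (dist_le_walk xq qy) _; rewrite lee_fin.
Qed.

End Shortcut.

(** * The glued graph and its DAMs *)

Section Glue.
Context (G : lgraph R V) (TG : T \subset vertices G).

Definition glue_vertices := (S :|: \bigcup_i phi i @: vertices G)%SET.
Definition glue_edges :=
  (\bigcup_i [set phi i @: (e : {set V}) | e in edges G])%SET.

Lemma glue_edgesP g :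
  reflect (exists i (e : {set V}), e \in edges G /\ g = phi i @: e)
    (g \in glue_edges).
Proof.
apply: (iffP bigcupP) => [[i _ /imsetP[e eG ->]]|[i [e [eG ->]]]].
  by exists i, e.
by exists i => //; apply: imset_f.
Qed.

Fact glue_graph_proof :
  [forall e in glue_edges, (#|e| == 2%N) && (e \subset glue_vertices)].
Proof.
apply/forall_inP => g /glue_edgesP[i [e [eG ->]]].
rewrite card_imset // (edge_card2 eG) /=.
apply: fintype.subset_trans (imsetS (phi i) (edge_subset eG)) _.
by rewrite /glue_vertices (bigD1 i) //= finset.setUCA finset.subsetUl.
Qed.

(** The picked pair is unique because copies share no edge; 0 is a default outside the edges. *)
Definition glue_len (g : {set W}) : R :=
  if [pick ie : I * {set V} | (ie.2 \in edges G) && (g == phi ie.1 @: ie.2)]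
  is Some ie then len G ie.2 else 0.

Lemma glue_lenE i (e : {set V}) :
  e \in edges G -> glue_len (phi i @: e) = len G e.
Proof.
move=> eG; rewrite /glue_len.
case: pickP => [[j e'] /= /andP[e'G /eqP ee']|/(_ (i, e))].
  have ij := copies_share_no_edge ee' (edge_card2 eG).
  by rewrite -ij in ee'; rewrite (imset_inj (@phi_inj i) ee').
by rewrite /= eG eqxx.
Qed.

Fact glue_len_gt0 e : e \in edges (Graph glue_graph_proof) -> 0 < glue_len e.
Proof.
by move=> /glue_edgesP[i [e' [eG ->]]]; rewrite glue_lenE // len_gt0.
Qed.

Definition glue : lgraph R W := LGraph glue_len_gt0.

Lemma glue_glued : glued glue.
Proof. by move=> g /glue_edgesP[i [e [_ ->]]]; exists i, e. Qed.

Lemma edges_pull_glue i : edges (pull i glue) = edges G.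
Proof.
apply/setP => e; rewrite inE; apply/glue_edgesP/idP => [[j [e' [eG ee']]]|eG].
  have ij := copies_share_no_edge (esym ee') (edge_card2 eG).
  by rewrite -ij in ee'; rewrite (imset_inj (@phi_inj j) ee').
by exists i, e.
Qed.

Lemma pull_glue i : pull i glue = base G.
Proof.
apply: graph_ext; last exact: edges_pull_glue.
apply/setP => v; rewrite inE /= finset.in_setU phi_S; apply/orP/idP => [[]|vG].
- exact: fintype.subsetP.
- case/bigcupP=> j _ /imsetP[v' v'G vv']; have [ij|ij] := eqVneq i j.
    by rewrite -ij in vv'; rewrite (phi_inj vv').
  by apply: (fintype.subsetP TG); apply: phi_meet vv'.
- by right; apply/bigcupP; exists i => //; apply: imset_f.
Qed.

Lemma dist_pull_glue i x y : dist (lpull i glue) x y = dist G x y.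
Proof.
have E := edges_pull_glue i.
apply/eqP; rewrite eq_le !dist_le_eq_len // => e.
  by move=> eG; rewrite /= glue_lenE.
by rewrite [edges _]E => eG; rewrite /= glue_lenE.
Qed.

Context (far_terminals : forall t t', t \in T -> t' \in T -> t != t' ->
  (1%:E <= dist G t t')%E).
Context (near_terminals : forall t t', t \in T -> t' \in T -> t != t' ->
  (dist G t t' <= L%:R%:E)%E).

Lemma separated_glue : separated glue.
Proof.
move=> j x p xp xT lT xl; rewrite -lee_fin.
apply: le_trans (far_terminals xT lT xl) _.
by rewrite -(dist_pull_glue j); apply: dist_le_walk.
Qed.

(** A walk that cannot be moved into copy [i] has length at least [L], and by [near_terminals] this
    does not beat the distance in [G]. *)
Lemma dist_glue i t t' : t \in T -> t' \in T ->
  dist glue (phi i t) (phi i t') = dist G t t'.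
Proof.
move=> tT t'T; have [->|tt'] := eqVneq t t'; first by rewrite !dist_refl.
apply/eqP; rewrite eq_le; apply/andP; split.
  by rewrite -(dist_pull_glue i) dist_pull_ge.
apply: le_trans (dist_pull_le glue_glued separated_glue i t'T t).
by rewrite dist_pull_glue le_min near_terminals /=.
Qed.

(** A DAM never shrinks distances between terminals, and distinct terminals of a copy are at
    distance at least 1 in the glued graph. *)
Lemma separated_DAM delta H : is_DAM S glue delta H -> separated H.
Proof.
move=> [_ HG] j x p xp xT lT xl; rewrite -lee_fin.
apply: le_trans (far_terminals xT lT xl) _; rewrite -(dist_glue j) //.
have [||h _] := HG (phi j x) (phi j (last x p)); rewrite ?phi_S //.
apply: le_trans h _; apply: le_trans (dist_pull_ge _ _ _ _) _.
exact: dist_le_walk.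
Qed.

(** Pigeonhole: non-terminals chosen in different copies are distinct, since copies meet only in
    terminals. *)
Lemma copy_without_nonterminals (H : graph W) :
  (#|vertices H :\: S| < #|I|)%N ->
  exists i, vertices (pull i H) :\: T = finset.set0.
Proof.
move=> HI; have [/existsP[i /eqP]|/existsPn none] :=
  boolP [exists i, vertices (pull i H) :\: T == finset.set0]; first by exists i.
have ex i : exists v, (v \notin T) && (phi i v \in vertices H).
  by have /finset.set0Pn[x] := none i; rewrite !inE => xP; exists x.
pose f i := phi i (xchoose (ex i)).
have f_inj : injective f.
  move=> i j fij; apply: contraTeq isT => ij.
  by have /andP[/negP[]] := xchooseP (ex i); apply: phi_meet fij.
move: HI; rewrite -(card_codom f_inj) ltnNge => /negP[].
apply: subset_leq_card; apply/fintype.subsetP => _ /codomP[i ->].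
by have := xchooseP (ex i); rewrite !inE /f phi_S.
Qed.

Lemma glue_DAM delta y :
  (forall t t', t \in T -> t' \in T -> t != t' ->
     (delta%:E * dist G t t' < L%:R%:E)%E) ->
  y < #|I|%:R -> has_DAM S glue delta y -> has_DAM T G delta 0.
Proof.
move=> short yI [H [HG Hy]].
have [i Hi0] : exists i, vertices (pull i H) :\: T = finset.set0.
  apply: copy_without_nonterminals; rewrite -(ltr_nat R).
  by apply: le_lt_trans yI.
have [gH mH] := pull_minor i glue_glued HG.1.
exists (lpull i H); split; last by rewrite /= Hi0 cards0.
split; first by rewrite -(pull_glue i).
move=> t t' tT t'T; have [<-|tt'] := eqVneq t t'.
  by rewrite !dist_refl mule0.
have [||lo up] := HG.2 (phi i t) (phi i t'); rewrite ?phi_S //.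
rewrite !dist_glue // in lo up; split.
  exact: le_trans lo (dist_pull_ge _ _ _ _).
have := dist_pull_le gH (separated_DAM HG) i t'T t.
(* If the minimum is [L], the distance in [H] is at least [L], which [short] excludes; otherwise it
   is realized inside the copy. *)
rewrite ge_min => /orP[LH|]; last by move/le_trans; apply.
by have := le_lt_trans (le_trans LH up) (short _ _ tT t'T tt'); rewrite ltxx.
Qed.

End Glue.

End Distances.
End Gluing.

(** * Copies along the hyperedges of a hypergraph *)

Section Copies.
Context {V K : finType} (T : {set V}) (F : {set {set K}}) (x0 : K).
Context (uF : uniform #|T| F).

Definition hyperedge := {e : {set K} | e \in F}.

(** Matches terminals with the vertices of the hyperedge in enumeration order; by uniformity the
    default [x0] is not reached for terminals. *)
Definition place (i : hyperedge) v := nth x0 (enum (val i)) (index v (enum T)).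

Lemma index_terminal (i : hyperedge) v :
  v \in T -> (index v (enum T) < size (enum (val i)))%N.
Proof. by move=> vT; rewrite -cardE (uF (valP i)) cardE index_mem mem_enum. Qed.

Lemma place_in i v : v \in T -> place i v \in val i.
Proof. by move=> vT; rewrite -mem_enum; apply/mem_nth/index_terminal. Qed.

Lemma place_inj i : {in T &, injective (place i)}.
Proof.
move=> v w vT wT /eqP; rewrite nth_uniq ?enum_uniq ?index_terminal // => /eqP.
by move=> vw; apply: (index_inj v (s := enum T)) vw; rewrite mem_enum.
Qed.

(** Terminals become hypergraph vertices, which copies may share; the tag [i] keeps non-terminals
    private to one copy. *)
Definition copy (i : hyperedge) (v : V) : K + hyperedge * V :=
  if v \in T then inl (place i v) else inr (i, v).

Lemma copyE i v : v \in T -> copy i v = inl (place i v).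
Proof. by rewrite /copy => ->. Qed.

(* A vertex that lies on no hyperedge becomes an isolated terminal. *)
Definition all_terminals : {set K + hyperedge * V} := [set inl x | x : K]%SET.

Lemma copy_inj i : injective (copy i).
Proof.
move=> v w; rewrite /copy; case: ifP => vT; case: ifP => wT //; last by case.
by case; apply: place_inj.
Qed.

Lemma copy_terminal i v : (copy i v \in all_terminals) = (v \in T).
Proof.
rewrite /copy; case: ifP => vT; first exact: imset_f.
by apply/imsetP => -[].
Qed.

Lemma copy_meet i j x y : i != j -> copy i x = copy j y -> x \in T.
Proof.
rewrite /copy; case: (x \in T) => // ij; case: ifP => // _ [eij].
by rewrite eij eqxx in ij.
Qed.

Lemma hops_reach i b n w : hops T copy i (inl b) n w ->
  exists2 a, w = inl a & reach (F :\ val i)%SET n a b.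
Proof.
elim=> [|{w} m j x y ji xT yT _ [a ya r]]; first by exists b; rewrite //= eqxx.
exists (place j x); first by rewrite /copy xT.
rewrite /copy yT in ya; case: ya r => <- r.
apply: reach_step (hop_edge (e := val j) _ (place_in j xT) (place_in j yT)) r.
by rewrite !inE (valP j) (inj_eq val_inj) ji.
Qed.

Context (L : nat) (gF : girth_gt L F).

Lemma copy_far i x y n : x \in T -> y \in T -> (n < L)%N ->
  hops T copy i (copy i y) n (copy i x) -> x = y.
Proof.
move=> xT yT nL; rewrite !copyE // => /hops_reach[_ [<-] r].
apply: (place_inj xT yT).
exact: gF (valP i) (place_in i xT) (place_in i yT) nL r.
Qed.

(** Two common vertices would be joined by one hop through copy [j], outside copy [i]; as [1 < L],
    the girth forces them to coincide. *)
Lemma copy_linear i j x y x' y' : (1 < L)%N -> i != j ->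
  copy i x = copy j y -> copy i x' = copy j y' -> x = x'.
Proof.
move=> L1 ij xy xy'; have ji : j != i by rewrite eq_sym.
have xT := copy_meet ij xy; have x'T := copy_meet ij xy'.
apply: (@copy_far i x x' 1) => //; rewrite xy xy'.
apply: hopsS (hops0 _ _ _ _) => //; first exact: copy_meet (esym xy).
exact: copy_meet (esym xy').
Qed.

End Copies.

(** * The number of copies, and the theorem *)

(** With [m = L - 1], [B = (s * D) ^ m] and [k = 2 * s * B], the exponent is [1 + 1/m] and
    [k^(1/m) <= 2 * s * (s * D)]. The power is thus at most [4 * s^3 * B * D], and the constant 8
    makes the inequality strict. *)
Lemma powR_card_bound (R : realType) (s D L : nat) : (0 < s)%N -> (0 < D)%N ->
  (1 < L)%N ->
  (8 * s%:R ^+ 3)^-1 * ((2 * s * (s * D) ^ L.-1)%:R `^ (L%:R / (L%:R - 1)))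
    < ((s * D) ^ L.-1 * D)%:R :> R.
Proof.
move=> s0 D0; case: L => // m; rewrite ltnS /= => m0.
set B := ((s * D) ^ m)%N; set k := (2 * s * B)%N.
have B0 : (0 < B)%N by rewrite expn_gt0 muln_gt0 s0 D0.
have k0 : (0 < k)%N by rewrite !muln_gt0 s0 B0.
have mR : m%:R != 0 :> R by rewrite pnatr_eq0 -lt0n.
have -> : m.+1%:R / (m.+1%:R - 1) = 1 + m%:R^-1 :> R.
  by rewrite -natr1 addrK mulrDl divff // mul1r.
rewrite powRD; last by rewrite pnatr_eq0 -lt0n k0 implybT.
rewrite powRr1 ?ler0n //.
have kle : k%:R `^ m%:R^-1 <= (2 * s * (s * D))%:R :> R.
  have -> : (2 * s * (s * D))%:R = ((2 * s * (s * D)) ^ m)%:R `^ m%:R^-1 :> R.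
    by rewrite natrX -powR_mulrn // -powRrM divff // powRr1.
  apply: ge0_ler_powR; rewrite ?nnegrE ?ler0n ?invr_ge0 ?ler0n //.
  rewrite ler_nat /k [leqRHS]expnMn leq_mul2r; apply/orP; right.
  by rewrite -{1}(expn1 (2 * s)) leq_pexp2l // muln_gt0.
have s3 : 0 < 8 * s%:R ^+ 3 :> R by rewrite mulr_gt0 // exprn_gt0 // ltr0n.
rewrite mulrC ltr_pdivrMr //.
apply: le_lt_trans (_ : k%:R * (2 * s * (s * D))%:R < _).
  by rewrite ler_wpM2l.
rewrite -natrX -!natrM ltr_nat /k.
have : (0 < B * D * s ^ 3)%N by rewrite !muln_gt0 B0 D0 s0.
nia.
Qed.

Theorem theorem3p12 (R : realType) (s : nat) (hs : (2 <= s)%N) :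
  exists c4 : R, 0 < c4 /\
  forall (V : finType) (Gstar : lgraph R V) (T : {set V}) (alpha beta : R)
    (L : nat),
    connected_graph Gstar ->
    T \subset vertices Gstar -> #|T| = s ->
    (forall t t', t \in T -> t' \in T -> t != t' ->
       (1%:E <= dist Gstar t t')%E /\ (dist Gstar t t' <= beta%:E)%E) ->
    SPR_distortion_ge T Gstar alpha ->
    (0 < L)%N ->
    Num.max 2 (Num.ceil beta) <= L%:Z ->
    L%:Z <= Num.ceil (alpha * beta) ->
    infinite_set [set k : nat |
      exists (W : finType) (G : lgraph R W) (S : {set W}),
        [/\ S \subset vertices G, #|S| = k
          & forall eps : R, 0 < eps ->
            ~ has_DAM S G (Num.min (L%:R / beta) alpha - eps)
                (c4 * (k%:R `^ (L%:R / (L%:R - 1))))]]%classic.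
Proof.
have s0 : (0 < s)%N by apply: ltnW.
exists (8 * s%:R ^+ 3)^-1; split.
  by rewrite invr_gt0 mulr_gt0 // exprn_gt0 // ltr0n.
move=> V G T alpha beta L _ TG Ts dT spr _ maxL _.
have /andP[L1 betaL] : (1 < L)%N && (beta <= L%:R).
  move: maxL; rewrite ge_max => /andP[L2 cL]; apply/andP; split; first by lia.
  apply: le_trans (ceil_ge beta) _; by rewrite -[L%:R]/((L%:Z)%:~R) ler_int.
have beta1 : 1 <= beta.
  have /card_gt1P[t [t' [tT t'T tt']]] : (1 < #|T|)%N by rewrite Ts.
  have [d1 d2] := dT _ _ tT t'T tt'; rewrite -lee_fin; exact: le_trans d1 d2.
(* The number of hypergraph vertices, hence of terminals, for the degree bound [D.+1], which is
   positive; distinct [D] give distinct values. *)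
pose k D := (2 * s * (s * D.+1) ^ L.-1)%N.
have k_inj : injective k.
  move=> D D' /eqP; rewrite eqn_pmul2l ?muln_gt0 // eqn_exp2r; last by lia.
  by rewrite eqn_pmul2l // eqSS => /eqP.
apply: (@sub_infinite_set _ (range k)); last first.
  rewrite (eq_finite_set (inj_card_eq (in2W k_inj))).
  exact: infinite_nat.
move=> _ [D _ <-].
have kD0 : (0 < k D)%N by rewrite !muln_gt0 s0 expn_gt0 muln_gt0 s0.
have [F [uF gF cF]] :=
  @exists_high_girth 'I_(k D) s D.+1 L hs isT L1 (card_ord _).
rewrite -Ts in uF; pose x0 := Ordinal kD0.
have linear := fun i j x y x' y' =>
  @copy_linear _ _ T F x0 uF L gF i j x y x' y' L1.
pose S := all_terminals (V := V) F.
exists _, (glue S (copy_inj uF) linear G), S; split.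
- exact: finset.subsetUl.
- by rewrite card_imset ?card_ord // => ? ? [].
move=> eps eps0 dam.
have short t t' : t \in T -> t' \in T -> t != t' ->
    ((Num.min (L%:R / beta) alpha - eps)%:E * dist G t t' < L%:R%:E)%E.
  move=> tT t'T tt'; have := dT _ _ tT t'T tt'.
  case: (dist G t t') => [d|[]//|[]//]; rewrite !lee_fin -EFinM lte_fin.
  move=> -[d1 d2].
  set delta := _ - eps.
  have dL : delta < L%:R / beta.
    by rewrite ltrBlDr ltr_pwDr // ge_min lexx.
  (* The bound [d <= beta] may be multiplied by [delta] only if [delta] is positive; otherwise the
     product is at most 0. *)
  have [delta0|delta0] := leP delta 0.
    apply: (@le_lt_trans _ _ 0); last by rewrite ltr0n ltnW.
    by rewrite mulr_le0_ge0 // (le_trans ler01).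
  apply: (@le_lt_trans _ _ (delta * beta)); first by rewrite ler_pM2l.
  by rewrite -ltr_pdivlMr // (lt_le_trans ltr01).
have near t t' : t \in T -> t' \in T -> t != t' -> (dist G t t' <= L%:R%:E)%E.
  move=> tT t'T tt'; apply: le_trans (dT _ _ tT t'T tt').2 _.
  by rewrite lee_fin.
have far t t' tT t'T tt' := (dT t t' tT t'T tt').1.
have many : (8 * s%:R ^+ 3)^-1 * ((k D)%:R `^ (L%:R / (L%:R - 1)))
    < #|{: hyperedge F}|%:R :> R.
  apply: lt_le_trans (powR_card_bound _ s0 (ltn0Sn D) L1) _.
  by rewrite ler_nat card_sig; apply: leq_trans cF _.
(* The DAM of [G] without non-terminals would give [alpha] at most the minimum minus [eps], which is
   below [alpha]. *)
have /spr := glue_DAM (@copy_terminal _ _ _ _ _) (@copy_meet _ _ _ _ _)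
  (@copy_far _ _ _ _ _ uF _ gF) TG far near short many dam.
rewrite leNgt => /negP[].
by rewrite ltrBlDr ltr_pwDr // ge_min lexx orbT.
Qed.
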